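(* Let $\mathcal{C}$ be a category. A Grothendieck coverage on $\mathcal{C}$ is the same thing as a coalgebra structure on $\mathcal{C}$ for the copointed endo-2-functor $(\mathbb{S},\pi)$ of $\mathbf{Cat}$, i.e. a functor $J:\mathcal{C}\to\mathbb{S}\mathcal{C}$ with $\pi_{\mathcal{C}}J=1_{\mathcal{C}}$; the coverage corresponding to such a $J$ has as covering sieves on $c$ those in the filter $J(c)$.
   Context: A sieve on an object $c$ of $\mathcal{C}$ is a set of arrows with codomain $c$ closed under precomposition; sieves on $c$ are ordered by inclusion. For $u:b\to c$ and a sieve $S$ on $c$, $u^*S=\{v\mid uv\in S\}$. A Grothendieck coverage on $\mathcal{C}$ is an assignment to each $c$ of a set $J(c)$ of sieves on $c$ such that the maximal sieve is in $J(c)$ (maximality), $J(c)$ is up-closed for inclusion, and for $S\in J(c)$ and $u:b\to c$ one has $u^*S\in J(b)$ (stability). A filter on $c$ means a non-empty up-closed set of sieves on $c$ (hence containing the maximal sieve; closure under intersection is not required). The category $\mathbb{S}\mathcal{C}$ has as objects pairs $(c,F)$ with $c$ in $\mathcal{C}$ and $F$ a filter on $c$; a morphism $(c,F)\to(c',F')$ is an arrow $u:c\to c'$ in $\mathcal{C}$ such that $u^*R\in F$ for all $R\in F'$. $\mathbb{S}$ is an endo-2-functor of $\mathbf{Cat}$: for $f:\mathcal{C}\to\mathcal{D}$, $\mathbb{S}f$ sends $(c,F)$ to $(f(c),\mathrm{lext}_f[F])$, where $\mathrm{lext}_f[F]$ is the up-closure of the set of sieves on $f(c)$ generated by the families $\{f(u)\mid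 u\in S\}$, $S\in F$, and $\mathbb{S}\phi$ has component $\phi_c$ at $(c,F)$ for a natural transformation $\phi$. It is copointed by the projections $\pi_{\mathcal{C}}:\mathbb{S}\mathcal{C}\to\mathcal{C}$, $(c,F)\mapsto c$. A coalgebra for a copointed endofunctor $(T,\varepsilon)$ is an object $C$ with $\gamma:C\to TC$ such that $\varepsilon_C\gamma=1_C$. *)

(* Defs.v *)
From Stdlib Require Import ssreflect ssrfun.
From Stdlib Require Import FunctionalExtensionality PropExtensionality.
From Stdlib Require Import ProofIrrelevance JMeq.

Set Implicit Arguments.
Unset Strict Implicit.
Unset Printing Implicit Defensive.

(* Plain Rocq + Stdlib.  Arrows, objects and functors are compared by Leibniz
   equality: Cat is the strict 2-category whose objects are the [category]s.
   The universe of objects is at least that of arrows, which makes the category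
   of sieve filters [SF C] again a [category]. *)

Record category := Category {
  obj :> Type;
  hom : obj -> obj -> Type;
  idc : forall a, hom a a;
  comp : forall a b c, hom b c -> hom a b -> hom a c;
  comp1l : forall a b (u : hom a b), comp (idc b) u = u;
  comp1r : forall a b (u : hom a b), comp u (idc a) = u;
  compA : forall a b c d (w : hom c d) (v : hom b c) (u : hom a b),
    comp w (comp v u) = comp (comp w v) u
}.
Arguments hom {c} a b : rename.
Arguments idc {c} a : rename.

Declare Scope cat_scope.
Delimit Scope cat_scope with cat.
Local Open Scope cat_scope.
Notation "g ∘ f" := (comp g f) (at level 40, left associativity) : cat_scope.

Record functor (C D : category) := Functor {
  fobj :> C -> D;
  fmap : forall a b, hom a b -> hom (fobj a) (fobj b);
  fmap1 : forall a, fmap (idc a) = idc (fobj a);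
  fmapM : forall a b c (v : hom b c) (u : hom a b),
    fmap (v ∘ u) = fmap v ∘ fmap u
}.
Arguments fmap {C D} f {a b} u : rename.

Record nat_trans (C D : category) (f g : functor C D) := NatTrans {
  component :> forall c, hom (f c) (g c);
  naturality : forall a b (u : hom a b),
    component b ∘ fmap f u = fmap g u ∘ component a
}.

Section Cat.

Definition idF (C : category) : functor C C :=
  @Functor C C (fun c => c) (fun _ _ u => u)
    (fun _ => erefl _) (fun _ _ _ _ _ => erefl _).

Definition compF (C D E : category) (g : functor D E) (f : functor C D) :
  functor C E.
Proof.
refine (@Functor C E (fun c => g (f c)) (fun _ _ u => fmap g (fmap f u)) _ _).
- by move=> a; rewrite !fmap1.
- by move=> a b c v u; rewrite !fmapM.
Defined.

Definition idN (C D : category) (f : functor C D) : nat_trans f f.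
Proof.
refine (@NatTrans C D f f (fun c => idc (f c)) _).
by move=> a b u; rewrite comp1l comp1r.
Defined.

Definition vcompN (C D : category) (f g h : functor C D)
  (psi : nat_trans g h) (phi : nat_trans f g) : nat_trans f h.
Proof.
refine (@NatTrans C D f h (fun c => psi c ∘ phi c) _).
by move=> a b u; rewrite -compA naturality compA naturality compA.
Defined.

Definition hcompN (C D E : category) (f f' : functor C D) (g g' : functor D E)
  (psi : nat_trans g g') (phi : nat_trans f f') :
  nat_trans (compF g f) (compF g' f').
Proof.
refine (@NatTrans C E (compF g f) (compF g' f')
          (fun c => psi (f' c) ∘ fmap g (phi c)) _).
move=> a b u /=.
by rewrite -compA -fmapM (naturality phi) fmapM compA (naturality psi) compA.
Defined.

End Cat.

(* Strict endo-2-functors of Cat.  In [two_hcomp] and [copoint_nat2] the two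
   sides are 2-cells between 1-cells that are equal (by [two_comp], resp.
   [copoint_nat]) but not convertible, hence the heterogeneous equality. *)
Record endo_2functor := Endo2Functor {
  two_obj :> category -> category;
  two_map : forall C D, functor C D -> functor (two_obj C) (two_obj D);
  two_nat : forall C D (f g : functor C D),
    nat_trans f g -> nat_trans (two_map f) (two_map g);
  two_id : forall C, two_map (idF C) = idF (two_obj C);
  two_comp : forall C D E (g : functor D E) (f : functor C D),
    two_map (compF g f) = compF (two_map g) (two_map f);
  two_idN : forall C D (f : functor C D), two_nat (idN f) = idN (two_map f);
  two_vcomp : forall C D (f g h : functor C D)
      (psi : nat_trans g h) (phi : nat_trans f g),
    two_nat (vcompN psi phi) = vcompN (two_nat psi) (two_nat phi);
  two_hcomp : forall C D E (f f' : functor C D) (g g' : functor D E)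
      (psi : nat_trans g g') (phi : nat_trans f f'),
    JMeq (two_nat (hcompN psi phi)) (hcompN (two_nat psi) (two_nat phi))
}.

Record copointed_endo_2functor := CopointedEndo2Functor {
  copointed_functor :> endo_2functor;
  copoint : forall C, functor (copointed_functor C) C;
  copoint_nat : forall C D (f : functor C D),
    compF (copoint D) (two_map copointed_functor f) = compF f (copoint C);
  copoint_nat2 : forall C D (f g : functor C D) (phi : nat_trans f g),
    JMeq (hcompN (idN (copoint D)) (two_nat copointed_functor phi))
         (hcompN phi (idN (copoint C)))
}.

Record coalgebra (T : copointed_endo_2functor) (C : category) := Coalgebra {
  coalg_map :> functor C (T C);
  coalg_counit : compF (copoint T C) coalg_map = idF C
}.

Record sieve (C : category) (c : C) := Sieve {
  arrows :> forall b, hom b c -> Prop;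
  sieve_closed : forall a b (u : hom b c) (v : hom a b),
    arrows u -> arrows (u ∘ v)
}.

Definition subsieve (C : category) (c : C) (R S : sieve c) : Prop :=
  forall b (u : hom b c), R b u -> S b u.

Definition max_sieve (C : category) (c : C) : sieve c :=
  @Sieve C c (fun _ _ => True) (fun _ _ _ _ _ => I).

Definition pullback_sieve (C : category) (b c : C) (u : hom b c) (S : sieve c) :
  sieve b.
Proof.
refine (@Sieve C b (fun a v => S a (u ∘ v)) _).
by move=> a a' v w; rewrite compA; apply: sieve_closed.
Defined.

Definition generated_sieve (C : category) (c : C)
  (P : forall b, hom b c -> Prop) : sieve c.
Proof.
refine (@Sieve C c (fun a w => exists b (u : hom b c) (v : hom a b),
                      P b u /\ w = u ∘ v) _).
move=> a' a w x [b [u [v [Pu ->]]]].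
by exists b, u, (v ∘ x); split=> //; rewrite compA.
Defined.

Inductive image_family (C D : category) (f : functor C D) (c : C)
    (P : forall b, hom b c -> Prop) : forall d, hom d (f c) -> Prop :=
  ImageFamily b (u : hom b c) of P b u : @image_family C D f c P (f b) (fmap f u).

Definition image_sieve (C D : category) (f : functor C D) (c : C) (S : sieve c) :
  sieve (f c) := generated_sieve (@image_family C D f c S).

Lemma image_sieveP (C D : category) (f : functor C D) (c : C) (S : sieve c)
  (d : D) (w : hom d (f c)) :
  image_sieve f S d w <->
  exists b (u : hom b c) (v : hom d (f b)), S b u /\ w = fmap f u ∘ v.
Proof.
split=> [[b [fu [v [Pu ->]]]]|[b [u [v [Su ->]]]]].
  by case: {b fu} Pu v => b u Su v; exists b, u, v.
by exists (f b), (fmap f u), v; split.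
Qed.

Record coverage (C : category) := Coverage {
  covers :> forall c : C, sieve c -> Prop;
  covers_max : forall c, covers (max_sieve c);
  covers_up : forall c (R S : sieve c), subsieve R S -> covers R -> covers S;
  covers_stable : forall b c (u : hom b c) (S : sieve c),
    covers S -> covers (pullback_sieve u S)
}.

(* Non-empty and up-closed only; closure under intersection is not required. *)
Record filter (C : category) (c : C) := Filter {
  filter_mem :> sieve c -> Prop;
  filter_inhab : exists S, filter_mem S;
  filter_up : forall R S : sieve c, subsieve R S -> filter_mem R -> filter_mem S
}.

Section Extensionality.

Lemma sieve_ext (C : category) (c : C) (R S : sieve c) :
  subsieve R S -> subsieve S R -> R = S.
Proof.
case: R S => [R pR] [S pS] RS SR.
have E : R = S.
  apply: functional_extensionality_dep => b; apply: functional_extensionality => u.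
  by apply: propositional_extensionality; split; [apply: RS | apply: SR].
by subst S; rewrite (proof_irrelevance _ pR pS).
Qed.

Lemma filter_ext (C : category) (c : C) (F G : filter c) :
  (forall S, F S <-> G S) -> F = G.
Proof.
case: F G => [F p q] [G p' q'] /= E.
have {}E : F = G.
  apply: functional_extensionality => S; exact: propositional_extensionality.
by subst G; rewrite (proof_irrelevance _ p p') (proof_irrelevance _ q q').
Qed.

Lemma functor_ext (C D : category) (f g : functor C D) :
  (forall c, f c = g c) ->
  (forall a b (u : hom a b), JMeq (fmap f u) (fmap g u)) -> f = g.
Proof.
case: f g => [f0 f1 p q] [g0 g1 p' q'] /= E0 E1.
have {}E0 : f0 = g0 by exact: functional_extensionality.
subst g0.
have {}E1 : f1 = g1.
  do 3! (apply: functional_extensionality_dep => ?); exact: JMeq_eq.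
by subst g1; rewrite (proof_irrelevance _ p p') (proof_irrelevance _ q q').
Qed.

Lemma nat_trans_ext (C D : category) (f g : functor C D)
  (phi psi : nat_trans f g) : (forall c, phi c = psi c) -> phi = psi.
Proof.
case: phi psi => [phi p] [psi p'] /= E.
have {}E : phi = psi by exact: functional_extensionality_dep.
by subst psi; rewrite (proof_irrelevance _ p p').
Qed.

Lemma nat_trans_JMeq (C D : category) (f g f' g' : functor C D)
  (phi : nat_trans f g) (psi : nat_trans f' g') :
  f = f' -> g = g' -> (forall c, JMeq (phi c) (psi c)) -> JMeq phi psi.
Proof.
move=> Ef Eg; subst f' g' => E.
have -> : phi = psi by apply: nat_trans_ext => c; exact: JMeq_eq.
exact: JMeq_refl.
Qed.

End Extensionality.

(* The category of pairs (point, filter of sieves on it), as an endo-2-functor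
   of Cat copointed by the projection to the point. *)
Section SieveFilterCategory.

Record sf_obj (C : category) := SFObj { sf_pt : C; sf_filter : filter sf_pt }.

Record sf_hom (C : category) (X Y : sf_obj C) := SFHom {
  sf_arr : hom (sf_pt X) (sf_pt Y);
  sf_arrP : forall R, sf_filter Y R -> sf_filter X (pullback_sieve sf_arr R)
}.

Lemma sf_hom_ext (C : category) (X Y : sf_obj C) (u v : sf_hom X Y) :
  sf_arr u = sf_arr v -> u = v.
Proof.
case: u v => [u p] [v p'] /= E; subst v.
by rewrite (proof_irrelevance _ p p').
Qed.

Lemma sf_hom_JMeq (C : category) (c d : C) (F F' : filter c) (G G' : filter d)
  (u : sf_hom (SFObj F) (SFObj G)) (v : sf_hom (SFObj F') (SFObj G')) :
  F = F' -> G = G' -> sf_arr u = sf_arr v -> JMeq u v.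
Proof.
move=> EF EG E; subst F' G'.
by rewrite (sf_hom_ext E); exact: JMeq_refl.
Qed.

Definition sf_id (C : category) (X : sf_obj C) : sf_hom X X.
Proof.
refine (@SFHom C X X (idc (sf_pt X)) _) => R.
by apply: filter_up => b u /=; rewrite comp1l.
Defined.

Definition sf_comp (C : category) (X Y Z : sf_obj C)
  (v : sf_hom Y Z) (u : sf_hom X Y) : sf_hom X Z.
Proof.
refine (@SFHom C X Z (sf_arr v ∘ sf_arr u) _) => R /(sf_arrP v) /(sf_arrP u).
by apply: filter_up => b w /=; rewrite compA.
Defined.

Definition SF (C : category) : category.
Proof.
refine (@Category (sf_obj C) (@sf_hom C) (@sf_id C) (@sf_comp C) _ _ _).
- by move=> *; apply: sf_hom_ext; exact: comp1l.
- by move=> *; apply: sf_hom_ext; exact: comp1r.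
- by move=> *; apply: sf_hom_ext; exact: compA.
Defined.

Definition lext (C D : category) (f : functor C D) (c : C) (F : filter c) :
  filter (f c).
Proof.
refine (@Filter D (f c)
          (fun R => exists2 S : sieve c, F S & subsieve (image_sieve f S) R) _ _).
- by case: (filter_inhab F) => S FS; exists (image_sieve f S), S.
- by move=> R R' RR' [S FS SR]; exists S => // b u /SR /RR'.
Defined.

Definition SF_map_hom (C D : category) (f : functor C D) (X Y : sf_obj C)
  (u : sf_hom X Y) :
  sf_hom (SFObj (lext f (sf_filter X))) (SFObj (lext f (sf_filter Y))).
Proof.
refine (@SFHom D (SFObj (lext f (sf_filter X))) (SFObj (lext f (sf_filter Y)))
          (fmap f (sf_arr u)) _) => R [S YS SR].
exists (pullback_sieve (sf_arr u) S); first exact: sf_arrP.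
move=> a w /image_sieveP [b [v [v' [Sv ->]]]]; apply/SR/image_sieveP.
by exists b, (sf_arr u ∘ v), v'; rewrite fmapM compA.
Defined.

Definition SF_map (C D : category) (f : functor C D) : functor (SF C) (SF D).
Proof.
refine (@Functor (SF C) (SF D)
          (fun X => SFObj (lext f (sf_filter X))) (@SF_map_hom C D f) _ _).
- by move=> X; apply: sf_hom_ext; exact: fmap1.
- by move=> *; apply: sf_hom_ext; exact: fmapM.
Defined.

Definition SF_nat_component (C D : category) (f g : functor C D)
  (phi : nat_trans f g) (X : sf_obj C) :
  sf_hom (SFObj (lext f (sf_filter X))) (SFObj (lext g (sf_filter X))).
Proof.
refine (@SFHom D (SFObj (lext f (sf_filter X))) (SFObj (lext g (sf_filter X)))
          (phi (sf_pt X)) _) => R [S XS SR].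
exists S => // a w /image_sieveP [b [v [v' [Sv ->]]]]; apply/SR/image_sieveP.
by exists b, v, (phi b ∘ v'); rewrite !compA naturality.
Defined.

Definition SF_nat (C D : category) (f g : functor C D) (phi : nat_trans f g) :
  nat_trans (SF_map f) (SF_map g).
Proof.
refine (@NatTrans (SF C) (SF D) (SF_map f) (SF_map g)
          (SF_nat_component phi) _).
by move=> *; apply: sf_hom_ext; exact: naturality.
Defined.

Definition SF_proj (C : category) : functor (SF C) C :=
  @Functor (SF C) C (@sf_pt C) (@sf_arr C)
    (fun _ => erefl _) (fun _ _ _ _ _ => erefl _).

Lemma lext_id (C : category) (c : C) (F : filter c) : lext (idF C) F = F.
Proof.
apply: filter_ext => R; split.
- move=> [S FS SR]; apply: filter_up FS => b u Su; apply/SR/image_sieveP.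
  by exists b, u, (idc b); rewrite comp1r.
- move=> FR; exists R => // a w /image_sieveP [b [v [v' [Rv ->]]]].
  exact: sieve_closed.
Qed.

Lemma lext_comp (C D E : category) (g : functor D E) (f : functor C D)
  (c : C) (F : filter c) : lext (compF g f) F = lext g (lext f F).
Proof.
apply: filter_ext => R; split.
- move=> [S FS SR]; exists (image_sieve f S); first by exists S.
  move=> a w /image_sieveP [d [u [v [/image_sieveP [b [s [x [Ss ->]]]] ->]]]].
  apply/SR/image_sieveP; exists b, s, (fmap g x ∘ v).
  by rewrite fmapM compA.
- move=> [T [S FS ST] TR]; exists S => //.
  move=> a w /image_sieveP [b [s [v [Ss ->]]]]; apply/TR/image_sieveP.
  exists (f b), (fmap f s), v; split=> //; apply/ST/image_sieveP.
  by exists b, s, (idc (f b)); rewrite comp1r.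
Qed.

Lemma SF_map_id (C : category) : SF_map (idF C) = idF (SF C).
Proof.
apply: functor_ext => [[c F]|[c F] [d G] u] /=; first by rewrite lext_id.
by apply: sf_hom_JMeq; rewrite ?lext_id.
Qed.

Lemma SF_map_comp (C D E : category) (g : functor D E) (f : functor C D) :
  SF_map (compF g f) = compF (SF_map g) (SF_map f).
Proof.
apply: functor_ext => [[c F]|[c F] [d G] u] /=; first by rewrite lext_comp.
by apply: sf_hom_JMeq; rewrite ?lext_comp.
Qed.

Definition SF_2functor : endo_2functor.
Proof.
refine (@Endo2Functor SF SF_map SF_nat SF_map_id SF_map_comp _ _ _).
- by move=> *; apply: nat_trans_ext => X; exact: sf_hom_ext.
- by move=> *; apply: nat_trans_ext => X; exact: sf_hom_ext.
- move=> C D E f f' g g' psi phi.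
  apply: nat_trans_JMeq; [exact: SF_map_comp | exact: SF_map_comp | case=> c F].
  by apply: sf_hom_JMeq; rewrite ?lext_comp.
Defined.

Definition SF_copointed : copointed_endo_2functor.
Proof.
refine (@CopointedEndo2Functor SF_2functor SF_proj _ _).
- by move=> C D f; apply: functor_ext.
- move=> C D f g phi.
  apply: nat_trans_JMeq; [exact: functor_ext | exact: functor_ext | case=> c F /=].
  by rewrite fmap1 comp1l comp1r.
Defined.

End SieveFilterCategory.

(* Main.v *)
Require Import Defs.
From Stdlib Require Import ssreflect ssrfun.
From Stdlib Require Import FunctionalExtensionality PropExtensionality.
From Stdlib Require Import ProofIrrelevance JMeq.

(** The three axioms of a coverage [K] are the three parts of a section of the
    projection.  Maximality and up-closure say that the covering sieves on [c]
    form a filter [coverage_filter K c], since a non-empty up-closed set of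
    sieves is an up-closed one containing the maximal sieve.  Stability of [K]
    under pullback along [u] says that [u] is a morphism of the category of
    sieve filters from [(b, K b)] to [(c, K c)].  As a section of the projection
    must send [u] to a morphism with underlying arrow [u], and a morphism is
    determined by its underlying arrow, functoriality is then automatic:
    the section is determined by its filters ([coverage_coalgebra]).

    The difficulty lies in strictness: for a coalgebra [J] the point of [J c]
    is only propositionally equal to [c], and the arrow underlying [fmap J u]
    only heterogeneously equal to [u].  So the covering sieves of [J] are
    defined relationally, through any filter [F] on [c] with [J c = SFObj F];
    such an [F] exists ([coalgebra_filter_exists]) and is unique
    ([SFObj_inj]).  The facts that compare morphisms ([sf_hom_pullback],
    [sf_hom_JMeq_arr]) are stated for arbitrary objects of the category of
    sieve filters together with equations, which can be eliminated there. *)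

Set Implicit Arguments.
Unset Strict Implicit.
Unset Printing Implicit Defensive.

Local Open Scope cat_scope.

Lemma coverage_ext (C : category) (K L : coverage C) :
  (forall (c : C) (S : sieve c), K c S <-> L c S) -> K = L.
Proof.
case: K L => [K p q r] [L p' q' r'] /= E.
have {}E : K = L.
  apply: functional_extensionality_dep => c.
  apply: functional_extensionality => S; exact: propositional_extensionality.
subst L.
by rewrite (proof_irrelevance _ p p') (proof_irrelevance _ q q')
           (proof_irrelevance _ r r').
Qed.

Lemma coalgebra_ext (T : copointed_endo_2functor) (C : category)
  (J K : coalgebra T C) : coalg_map J = coalg_map K -> J = K.
Proof.
case: J K => [J p] [K p'] /= E; subst K.
by rewrite (proof_irrelevance _ p p').
Qed.

Lemma fmap_JMeq (C D : category) (f g : functor C D) (a b : C) (u : hom a b) :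
  f = g -> JMeq (fmap f u) (fmap g u).
Proof. by move=> ->; exact: JMeq_refl. Qed.

Lemma SFObj_inj (C : category) (c : C) (F G : filter c) :
  SFObj F = SFObj G -> F = G.
Proof.
move=> E; apply: JMeq_eq.
change (JMeq (sf_filter (SFObj F)) (sf_filter (SFObj G))).
by rewrite E; exact: JMeq_refl.
Qed.

Lemma sf_obj_over (C : category) (X : sf_obj C) (c : C) :
  sf_pt X = c -> exists F : filter c, X = SFObj F.
Proof. by case: X => d F /= E; subst d; exists F. Qed.

(** The defining property of a morphism of sieve filters, transported to the
    points that its source, target and underlying arrow are equal to. *)
Lemma sf_hom_pullback (C : category) (X Y : sf_obj C) (w : sf_hom X Y)
  (b c : C) (F : filter b) (G : filter c) (u : hom b c) (S : sieve c) :
  X = SFObj F -> Y = SFObj G -> JMeq (sf_arr w) u ->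
  G S -> F (pullback_sieve u S).
Proof.
move=> EX EY; subst X Y => /(@JMeq_eq _ _ _) <-.
exact: (sf_arrP w).
Qed.

Lemma sf_hom_JMeq_arr (C : category) (X X' Y Y' : sf_obj C)
  (u : sf_hom X Y) (v : sf_hom X' Y') :
  X = X' -> Y = Y' -> JMeq (sf_arr u) (sf_arr v) -> JMeq u v.
Proof.
move=> EX EY; subst X' Y' => /(@JMeq_eq _ _ _) /sf_hom_ext ->.
exact: JMeq_refl.
Qed.

Section CoverageOfCoalgebra.

Variables (C : category) (J : coalgebra SF_copointed C).

Lemma coalgebra_filter_exists (c : C) : exists F : filter c, J c = SFObj F.
Proof.
apply: sf_obj_over.
exact: (f_equal (fun f : functor C C => f c) (coalg_counit J)).
Qed.

Lemma coalgebra_arr (b c : C) (u : hom b c) :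
  JMeq (sf_arr (fmap (coalg_map J) u)) u.
Proof. exact: (fmap_JMeq u (coalg_counit J)). Qed.

(** The filter of [J c], read as one on [c] itself; the existential replaces a
    transport along the equation between the point of [J c] and [c]. *)
Definition coalgebra_covers (c : C) (S : sieve c) : Prop :=
  exists2 F : filter c, J c = SFObj F & F S.

Lemma coalgebra_coversE (c : C) (F : filter c) (S : sieve c) :
  J c = SFObj F -> coalgebra_covers S <-> F S.
Proof.
move=> JF; split=> [[G JG GS]|FS]; last by exists F.
by rewrite (SFObj_inj (eq_trans (esym JF) JG)).
Qed.

Definition coalgebra_coverage : coverage C.
Proof.
refine (@Coverage C coalgebra_covers _ _ _).
- move=> c; have [F JF] := coalgebra_filter_exists c; exists F => //.
  by have [S FS] := filter_inhab F; apply: filter_up FS.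
- by move=> c R S RS [F JF FR]; exists F => //; exact: filter_up FR.
- move=> b c u S [G JG GS]; have [F JF] := coalgebra_filter_exists b.
  by exists F => //; exact: (sf_hom_pullback JF JG (coalgebra_arr u)).
Defined.

End CoverageOfCoalgebra.

Section CoalgebraOfCoverage.

Variables (C : category) (K : coverage C).

Definition coverage_filter (c : C) : filter c :=
  @Filter C c (K c) (ex_intro _ _ (covers_max K c)) (@covers_up C K c).

Definition coverage_functor : functor C (SF C).
Proof.
refine (@Functor C (SF C) (fun c => SFObj (coverage_filter c))
          (fun b c u => @SFHom C (SFObj (coverage_filter b))
             (SFObj (coverage_filter c)) u (@covers_stable C K b c u)) _ _).
- by move=> a; exact: sf_hom_ext.
- by move=> a b c v u; exact: sf_hom_ext.
Defined.

Definition coverage_coalgebra : coalgebra SF_copointed C.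
Proof.
by refine (@Coalgebra SF_copointed C coverage_functor _); exact: functor_ext.
Defined.

End CoalgebraOfCoverage.

Lemma coverage_coalgebraK (C : category) :
  cancel (@coverage_coalgebra C) (@coalgebra_coverage C).
Proof.
move=> K; apply: coverage_ext => c S.
exact: (@coalgebra_coversE C (coverage_coalgebra K) c (coverage_filter K c)).
Qed.

(** On objects both sides have the same filters; on arrows the counit law pins
    down the underlying arrow of [fmap J u], hence the whole morphism. *)
Lemma coalgebra_coverageK (C : category) :
  cancel (@coalgebra_coverage C) (@coverage_coalgebra C).
Proof.
move=> J; apply: coalgebra_ext.
have E c : coverage_functor (coalgebra_coverage J) c = J c.
  have [F JF] := coalgebra_filter_exists J c; rewrite JF.
  congr SFObj; apply: filter_ext => S; exact: coalgebra_coversE.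
apply: functor_ext => [|b c u]; first exact: E.
apply: sf_hom_JMeq_arr; [exact: E | exact: E | apply: JMeq_sym].
exact: coalgebra_arr.
Qed.

Theorem proposition3p3p1 (C : category) :
  exists cov : coalgebra SF_copointed C -> coverage C,
    bijective cov /\
    forall (J : coalgebra SF_copointed C) (c : C),
      exists F : filter c,
        J c = SFObj F /\ forall S : sieve c, cov J c S <-> F S.
Proof.
exists (@coalgebra_coverage C); split.
  exact: Bijective (@coalgebra_coverageK C) (@coverage_coalgebraK C).
move=> J c; have [F JF] := coalgebra_filter_exists J c.
by exists F; split=> // S; exact: coalgebra_coversE.
Qed.
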